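(* For all integers $n\geq 0$, \[ c\psi_{2,0}(n)=2\,\sigma\mathrm{mex}_2(n) \qquad\text{and}\qquad c\psi_{2,1}(n)=2\,\sigma\mathrm{mex}_2(n)-E_2(n). \]
   Context: Colored Frobenius partitions. A colored integer is a pair $(m,j)$ with $m$ a non-negative integer and $j$ a color; for two colors, $j\in\{0,1\}$. Colored integers are ordered lexicographically: first by the usual order on $m$, then by the color order $0<1$. For $a\in\{0,1\}$, a $(2,a)$-colored Frobenius partition is a two-rowed array \[ \Pi=\begin{pmatrix} a_1&a_2&\cdots&a_r\\ b_1&b_2&\cdots&b_s\end{pmatrix} \] (with $r,s\geq 0$; a row may be empty) such that: each entry is a colored integer with color in $\{0,1\}$; each row is strictly decreasing with respect to the lexicographic order; and $r-s=a-1$. Its weight is $|\Pi|=r+\sum_{i=1}^r a_i+\sum_{j=1}^s b_j$, where the numerical values of the entries are used and colors are ignored. $c\psi_{2,a}(n)$ denotes the number of $(2,a)$-colored Frobenius partitions of weight $n$. Minimal excludants. A partition is a finite weakly decreasing sequence of positive integers (possibly empty); $|\lambda|$ is the sum of its parts. For a partition $\lambda$, $\mathrm{mex}(\lambda):=\min\{m\geq 1: m\text{ is not a part of }\lambda\}$. A bipartition of $n$ is an ordered pair $\pi=(\pi_1,\pi_2)$ of partitions with $|\pi_1|+|\pi_2|=n$, written $\pi\vdash_2 n$. Put $\mathrm{mex}_2(\pi):=\min\{\mathrm{mex}(\pi_1),\mathrm{mex}(\pi_2)\}$ and \[ \sigma\mathrm{mex}_2(n):=\sum_{\pi\vdash_2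 n}\mathrm{mex}_2(\pi), \qquad E_2(n):=\#\{\pi=(\pi_1,\pi_2)\vdash_2 n:\mathrm{mex}(\pi_1)=\mathrm{mex}(\pi_2)\}. \] *)

(* Defs.v *)
From mathcomp Require Import all_boot all_order all_algebra.
From mathcomp Require Import finmap boolp classical_sets functions cardinality.
From mathcomp Require Import zify.

Set Implicit Arguments.
Unset Strict Implicit.
Unset Printing Implicit Defensive.

Import Order.TTheory.
Local Open Scope classical_set_scope.
Local Open Scope nat_scope.

(* The pair (m, j); [*l] equips the product with the lexicographic order. *)
Definition colored_int := (nat *l 'I_2)%type.

Definition frob_array := (seq colored_int * seq colored_int)%type.

Definition is_frob (a : nat) (P : frob_array) : bool :=
  [&& sorted >%O P.1, sorted >%O P.2 &
      ((size P.1)%:Z - (size P.2)%:Z == a%:Z - 1)%R].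

Definition frob_weight (P : frob_array) : nat :=
  size P.1 + \sum_(x <- P.1) x.1 + \sum_(y <- P.2) y.1.

Definition frob_set (a n : nat) : set frob_array :=
  [set P | is_frob a P /\ frob_weight P = n].

(* [fset_set] is the empty set on an infinite argument; [finite_frob_set] and
   [finite_bipartitions] below show that this default is never used here. *)
Definition cpsi2 (a n : nat) : nat := #|` fset_set (frob_set a n)|%fset.

Definition is_partition (l : seq nat) : bool :=
  sorted geq l && all (fun p => 0 < p) l.

Lemma mex_exists (l : seq nat) : exists m, (0 < m) && (m \notin l).
Proof.
exists (sumn l).+1; rewrite /=; apply/negP => ml.
have : (sumn l).+1 <= sumn l.
  rewrite {2}sumnE (big_rem _ ml) /=; exact: leq_addr.
by rewrite ltnn.
Qed.

Definition mex (l : seq nat) : nat := ex_minn (mex_exists l).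

Definition bipartitions (n : nat) : set (seq nat * seq nat) :=
  [set pi | [/\ is_partition pi.1, is_partition pi.2 &
                sumn pi.1 + sumn pi.2 = n]].

Definition mex2 (pi : seq nat * seq nat) : nat :=
  minn (mex pi.1) (mex pi.2).

Definition sigma_mex2 (n : nat) : nat :=
  \sum_(pi <- fset_set (bipartitions n)) mex2 pi.

Definition E2 (n : nat) : nat :=
  #|` fset_set [set pi | bipartitions n pi /\ mex pi.1 = mex pi.2]|%fset.

Lemma finite_bounded_seq (T : Type) (A : set T) (k : nat) : finite_set A ->
  finite_set [set s : seq T | size s <= k /\ forall i x0, i < size s ->
                                              A (nth x0 s i)].
Proof.
move=> finA; elim: k => [|k IHk].
  apply: (sub_finite_set _ (finite_set1 [::])) => s [] /=.
  by case: s.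
have fin2 := finite_image2 (@cons T) finA IHk.
have finU : finite_set ([set [::]] `|` [set x :: y | x in A & y in
    [set s : seq T | size s <= k /\ forall i x0, i < size s ->
                                              A (nth x0 s i)]]).
  by rewrite finite_setU; split.
apply: (sub_finite_set _ finU) => -[|x s] [/= ssz sA]; first by left.
right; exists x; first exact: (sA 0 x).
by exists s => //; split => // i x0 lti; exact: (sA i.+1 x0).
Qed.

Lemma leq_sum_nth (T : Type) (f : T -> nat) (s : seq T) (i : nat) (x0 : T) :
  i < size s -> f (nth x0 s i) <= \sum_(x <- s) f x.
Proof.
elim: s i => [|y s IHs] [|i] //= lti; rewrite big_cons ?leq_addr //.
exact: leq_trans (IHs _ lti) (leq_addl _ _).
Qed.

Lemma finite_frob_set (a n : nat) : finite_set (frob_set a n).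
Proof.
have finA : finite_set [set x : colored_int | x.1 <= n].
  have finI : finite_set ([set i : nat | i <= n] `*` [set: 'I_2]).
    apply: finite_setX; last exact: finite_finset.
    apply: (sub_finite_set _ (finite_II n.+1)) => i /=.
    by rewrite ltnS.
  by apply: (sub_finite_set _ finI) => x xn; split.
have finS := finite_bounded_seq n.+1 finA.
apply: (sub_finite_set _ (finite_setX finS finS)) => -[s t] [/=].
rewrite /is_frob /frob_weight /= => /and3P[_ _ /eqP st] wn.
split; (split=> [|i x0 lti] /=; first by lia).
- by have := leq_sum_nth (fun x : colored_int => x.1) x0 lti; rewrite /=; lia.
- by have := leq_sum_nth (fun x : colored_int => x.1) x0 lti; rewrite /=; lia.
Qed.

Lemma size_partition (l : seq nat) : is_partition l -> size l <= sumn l.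
Proof.
by case/andP=> _; elim: l => //= x l IHl /andP[x0 /IHl]; lia.
Qed.

Lemma finite_bipartitions (n : nat) : finite_set (bipartitions n).
Proof.
have finA : finite_set [set i : nat | i <= n].
  by apply: (sub_finite_set _ (finite_II n.+1)) => i /=; rewrite ltnS.
have finS := finite_bounded_seq n finA.
apply: (sub_finite_set _ (finite_setX finS finS)) => -[s t] [/=].
move=> /size_partition ps /size_partition pt stn.
split; (split=> [|i x0 lti] /=; first by lia).
- by have := leq_sum_nth id x0 lti; rewrite -sumnE /=; lia.
- by have := leq_sum_nth id x0 lti; rewrite -sumnE /=; lia.
Qed.

(* Main.v *)
(* Split each row by color: a Frobenius array becomes two pairs [(A, B)] of finite
   sets of naturals. As in the combinatorial proof of Jacobi's triple product,
   a pair of charge [z = |A| - |B|] amounts to a partition together with [z], and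
   the weight drops by [z (z + 1) / 2 = 1 + ... + k], where [k = z] if [z >= 0] and
   [k = - 1 - z] otherwise. Inserting the parts [1, ..., k] into that partition
   restores the weight, and the result is an arbitrary partition with [mex > k].
   Since the two charges add up to [a - 1], summing over the first charge expresses
   [cpsi2 a n] by the numbers of bipartitions with [mex pi.1 > i] and
   [mex pi.2 > j], which also give [sigma_mex2 n] and, by inclusion-exclusion,
   [E2 n]. *)

Require Import Defs.
From mathcomp Require Import all_boot all_order all_algebra.
From mathcomp Require Import finmap classical_sets cardinality.
From mathcomp Require Import zify.

Set Implicit Arguments.
Unset Strict Implicit.
Unset Printing Implicit Defensive.

Import Order.TTheory.

(** * Counting in sequences *)

Lemma count_bij (T U : eqType) (s : seq T) (t : seq U) (P : pred T)
    (Q : pred U) (f : T -> U) :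
  uniq s -> uniq t ->
  (forall x, x \in s -> P x -> (f x \in t) && Q (f x)) ->
  (forall x y, x \in s -> P x -> y \in s -> P y -> f x = f y -> x = y) ->
  (forall y, y \in t -> Q y -> exists2 x, (x \in s) && P x & f x = y) ->
  count P s = count Q t.
Proof.
move=> us ut fst finj fsurj; rewrite -!size_filter -(size_map f).
apply/perm_size/uniq_perm; rewrite ?filter_uniq //.
  rewrite map_inj_in_uniq ?filter_uniq // => x y.
  by rewrite !mem_filter => /andP[Px xs] /andP[Py ys]; exact: finj.
move=> y; rewrite mem_filter; apply/mapP/andP => [[x]|[Qy yt]].
  by rewrite mem_filter => /andP[Px xs] ->; have /andP[] := fst x xs Px.
have [x /andP[xs Px] <-] := fsurj y yt Qy.
by exists x; rewrite // mem_filter Px.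
Qed.

Lemma count_sum_ord (T : eqType) (s : seq T) (P : pred T) (f : T -> nat) N :
  (forall x, x \in s -> P x -> f x < N) ->
  count P s = \sum_(k < N) count (fun x => P x && (f x == k)) s.
Proof.
elim: s => [|x s IHs] fN /=; first by rewrite big1.
rewrite big_split /= -IHs => [|y ys]; last by apply: fN; rewrite inE ys orbT.
congr (_ + _); case Px: (P x) => /=; last by rewrite big1.
have fx : f x < N by apply: fN; rewrite ?mem_head.
rewrite (bigD1 (Ordinal fx)) //= eqxx big1 // => i ne.
by apply/eqP; rewrite eqb0; apply: contra ne => /eqP e; apply/eqP/val_inj.
Qed.

Lemma perm_cat_uniq_sub (T : eqType) (s t : seq T) :
  uniq s -> {subset s <= t} -> exists r, perm_eq t (s ++ r).
Proof.
elim: s t => [|x s IHs] t /=; first by exists t.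
case/andP=> xs us st; have /perm_to_rem tx := st x (mem_head _ _).
have [y ys|r tr] := IHs (rem x t) us.
  have : y \in x :: rem x t by rewrite -(perm_mem tx) st // inE ys orbT.
  by rewrite inE; case: eqP => // yx; rewrite -yx ys in xs.
by exists r; rewrite (permPl tx) perm_cons.
Qed.

Lemma gtn_trans : transitive gtn. Proof. by move=> ? ? ? /= *; lia. Qed.
Lemma gtn_irr : irreflexive gtn. Proof. by move=> ? /=; lia. Qed.
Lemma geq_trans : transitive geq. Proof. by move=> ? ? ? /= *; lia. Qed.
Lemma geq_anti : antisymmetric geq. Proof. by move=> ? ? /=; lia. Qed.
Lemma geq_total : total geq. Proof. by move=> ? ? /=; lia. Qed.

(** * Charged pairs of finite sets of naturals *)

(** Finite sets of naturals are decreasing lists, so a new 0 belongs at the end. [down] forgets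
    whether 0 was present; the flag [c] restores it. *)
Definition up (c : bool) (A : seq nat) : seq nat := map S A ++ nseq c 0.
Definition down (A : seq nat) : seq nat := map predn (filter (leq 1) A).

Lemma downK A : sorted gtn A -> up (0 \in A) (down A) = A.
Proof.
elim: A => //= -[|a] A IHA pA.
  case: A pA {IHA} => [|b A] //=; lia.
rewrite inE /= -[in RHS](IHA (path_sorted pA)) /up /down /=.
by [].
Qed.

Lemma upK c A : down (up c A) = A.
Proof.
rewrite /down /up filter_cat map_cat.
have -> : [seq x <- nseq c 0 | 0 < x] = [::] by case: c.
by rewrite cats0 filter_map (eq_filter (a2 := predT)) // filter_predT mapK.
Qed.

Lemma mem0_up c A : (0 \in up c A) = c.
Proof.
rewrite mem_cat mem_nseq; case: (0 \in map S A) / mapP => [[]|_] //=.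
by rewrite eqxx andbT lt0b.
Qed.

Lemma sorted_up c A : sorted gtn A -> sorted gtn (up c A).
Proof.
case: A => [|a A]; first by case: c.
rewrite /up /= cat_path path_map => ->.
by case: c => //=; rewrite last_map.
Qed.

Lemma sorted_down A : sorted gtn A -> sorted gtn (down A).
Proof.
move=> sA; rewrite -(downK sA) upK /down.
elim: A sA => //= -[|a] A IHA pA /=; first exact: IHA (path_sorted pA).
have := pA; rewrite !(path_sortedE gtn_trans) => /andP[/allP aA sA].
rewrite IHA // andbT; apply/allP => x /mapP[y].
by rewrite mem_filter => /andP[y0 /aA] /= + ->; lia.
Qed.

Lemma size_up c A : size (up c A) = size A + c.
Proof. by rewrite size_cat size_map size_nseq. Qed.

Lemma sumn_up c A : sumn (up c A) = sumn A + size A.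
Proof.
rewrite sumn_cat sumn_nseq mul0n addn0; elim: A => //= a A ->; lia.
Qed.

Definition pair_sorted (x : seq nat * seq nat) := sorted gtn x.1 && sorted gtn x.2.
Definition charge (x : seq nat * seq nat) : int :=
  ((size x.1)%:Z - (size x.2)%:Z)%R.
Definition weight (x : seq nat * seq nat) : nat :=
  size x.1 + sumn x.1 + sumn x.2.

(* [(A, B)] encodes the set of integers made of [A] and the [-1 - b] with [b] not
   in [B]; [shift] translates this set by one. *)
Definition shift (x : seq nat * seq nat) := (up (0 \notin x.2) x.1, down x.2).
(** Swapping the rows complements the encoded set and reflects it by [i -> -1 - i], which turns
    translation by one into its inverse. *)
Definition unshift x := swap_pair (shift (swap_pair x)).

Lemma pair_sorted_swap x : pair_sorted (swap_pair x) = pair_sorted x.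
Proof. by rewrite /pair_sorted /= andbC. Qed.

Lemma pair_sorted_shift x : pair_sorted x -> pair_sorted (shift x).
Proof. by case/andP=> s1 s2; rewrite /pair_sorted sorted_up ?sorted_down. Qed.

Lemma pair_sorted_unshift x : pair_sorted x -> pair_sorted (unshift x).
Proof.
by move=> sx; rewrite pair_sorted_swap pair_sorted_shift // pair_sorted_swap.
Qed.

Lemma shiftK x : pair_sorted x -> unshift (shift x) = x.
Proof.
case: x => A B /andP[/= sA sB].
by rewrite /unshift /shift /= upK mem0_up negbK downK.
Qed.

Lemma unshiftK x : pair_sorted x -> shift (unshift x) = x.
Proof.
rewrite -pair_sorted_swap => /shiftK; rewrite /unshift => e.
by apply: (can_inj (@swap_pairK _ _)).
Qed.

Lemma charge_shift x : pair_sorted x -> charge (shift x) = (charge x + 1)%R.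
Proof.
case: x => A B /andP[/= _ sB]; rewrite /charge /= size_up -{3}(downK sB) size_up.
by case: (0 \in B) => /=; lia.
Qed.

Lemma charge_unshift x :
  pair_sorted x -> charge (unshift x) = (charge x - 1)%R.
Proof.
move=> sx; rewrite -[in RHS](unshiftK sx) charge_shift ?pair_sorted_unshift //.
lia.
Qed.

(** The sum of the first row grows by its size, and that of the second drops by the number of its
    nonzero entries. Either a 0 disappears from the second row without lowering its sum, or a new 0
    counts in the size of the first; both give the final 1. *)
Lemma weight_shift x : pair_sorted x ->
  ((weight (shift x))%:Z = (weight x)%:Z + charge x + 1)%R.
Proof.
case: x => A B /andP[/= _ sB].
rewrite /charge /weight /= sumn_up size_up -{3 4}(downK sB) sumn_up size_up.
by case: (0 \in B) => /=; lia.
Qed.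

(* [z (z + 1) / 2] is ['C((stair z).+1, 2)] for both signs, as [Negz k] is [-k-1]. *)
Definition stair (z : int) : nat :=
  match z with Posz k => k | Negz k => k end.

Lemma stair_succ z :
  ('C((stair (z + 1)).+1, 2)%:Z = 'C((stair z).+1, 2)%:Z + z + 1)%R.
Proof.
case: z => [k|[|k]].
- have -> : (Posz k + 1)%R = Posz k.+1 by lia.
  by rewrite /= [in LHS]binS bin1; lia.
(* Here [z = -1]: the sign changes, and both triangular numbers are 0. *)
- by [].
- have -> : (Negz k.+1 + 1)%R = Negz k by lia.
  rewrite /= [in RHS]binS bin1; lia.
Qed.

Section Iter.
Variable x : seq nat * seq nat.
Hypothesis sx : pair_sorted x.

Lemma pair_sorted_iter_shift N : pair_sorted (iter N shift x).
Proof. by elim: N => //= N; exact: pair_sorted_shift. Qed.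

Lemma iter_shiftK N : iter N unshift (iter N shift x) = x.
Proof.
elim: N => // N IHN; rewrite iterSr /= shiftK //; exact: pair_sorted_iter_shift.
Qed.

Lemma charge_iter_shift N : charge (iter N shift x) = (charge x + N%:Z)%R.
Proof.
elim: N => /= [|N IHN]; first lia.
by rewrite charge_shift ?pair_sorted_iter_shift // IHN; lia.
Qed.

(** One shift raises the weight and the triangular number of the charge by the same amount, so their
    difference is invariant. *)
Lemma weight_iter_shift N :
  weight (iter N shift x) + 'C((stair (charge x)).+1, 2) =
  weight x + 'C((stair (charge (iter N shift x))).+1, 2).
Proof.
elim: N => //= N IHN; have sN := pair_sorted_iter_shift N.
have := weight_shift sN; rewrite charge_shift //.
have := stair_succ (charge (iter N shift x)).
move: IHN; move: (binomial _ _) (binomial _ _) (binomial _ _) => ? ? ?; lia.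
Qed.

Lemma pair_sorted_iter_unshift N : pair_sorted (iter N unshift x).
Proof. by elim: N => //= N; exact: pair_sorted_unshift. Qed.

Lemma charge_iter_unshift N : charge (iter N unshift x) = (charge x - N%:Z)%R.
Proof.
elim: N => /= [|N IHN]; first lia.
by rewrite charge_unshift ?pair_sorted_iter_unshift // IHN; lia.
Qed.

End Iter.

(** Each shift lowers the positive entries of the second row and deletes 0, so an entry [b] is gone
    after [b + 1] shifts; every entry is at most the sum. *)
Lemma iter_shift_nil N x : sumn x.2 < N -> (iter N shift x).2 = [::].
Proof.
have nilN M B : all (fun b => b < M) B -> iter M down B = [::].
  elim: M B => [|M IHM] B aB; first by case: B aB.
  rewrite iterSr IHM //; apply/allP => _ /mapP[b + ->].
  by rewrite mem_filter => /andP[b0 /(allP aB)]; lia.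
move=> xN; have -> : (iter N shift x).2 = iter N down x.2.
  by elim: (N) => //= M ->.
apply/nilN/allP => b; move: xN; elim: (x.2) => //= c B IHB xN.
by rewrite inE => /predU1P[->|/IHB]; [|apply]; lia.
Qed.

(** * The partition of a charged pair *)

(* [unstack] removes the staircase [r-1, ..., 1, 0] from a list of length [r]. *)
Fixpoint unstack (A : seq nat) : seq nat :=
  if A is a :: A' then a - size A' :: unstack A' else [::].
Fixpoint stack (l : seq nat) : seq nat :=
  if l is a :: l' then a + size l' :: stack l' else [::].

Lemma size_stack l : size (stack l) = size l.
Proof. by elim: l => //= a l ->. Qed.

Lemma size_unstack A : size (unstack A) = size A.
Proof. by elim: A => //= a A ->. Qed.

Lemma stackK l : unstack (stack l) = l.
Proof. by elim: l => //= a l ->; rewrite size_stack addnK. Qed.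

Lemma size_path_gtn a A : path gtn a A -> size A <= a.
Proof. by elim: A a => //= b A IHA a /andP[ab /IHA]; lia. Qed.

Lemma unstackK A : sorted gtn A -> stack (unstack A) = A.
Proof.
elim: A => //= a A IHA pA; rewrite IHA ?(path_sorted pA) // size_unstack subnK //.
exact: size_path_gtn.
Qed.

Lemma sorted_stack l : sorted geq l -> sorted gtn (stack l).
Proof.
elim: l => //= a [|b l] //= IHl /andP[ab /IHl ->]; rewrite andbT; lia.
Qed.

Lemma sorted_unstack A : sorted gtn A -> sorted geq (unstack A).
Proof.
elim: A => //= a [|b A] //= IHA /andP[ab /IHA ->]; rewrite andbT; lia.
Qed.

Lemma sumn_stack l : sumn (stack l) = sumn l + 'C(size l, 2).
Proof. by elim: l => //= a l ->; rewrite binS bin1; lia. Qed.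

Definition strip (A : seq nat) : seq nat := filter (leq 1) (unstack A).

Lemma sorted_zeros l : sorted geq l ->
  l = filter (leq 1) l ++ nseq (size l - size (filter (leq 1) l)) 0.
Proof.
elim: l => //= a l IHl pl; case: a pl => [|a] pl /=.
  have l0 : all (pred1 0) l.
    by move: pl; rewrite (path_sortedE geq_trans) => /andP[+ _];
       apply: sub_all => x /=; lia.
  have -> : filter (leq 1) l = [::].
    by apply/eqP; rewrite -(negbK (_ == _)) -has_filter -all_predC;
       apply: sub_all l0 => x /= /eqP ->.
  by rewrite subn0 /=; congr cons; apply/all_pred1P.
by rewrite subSS -IHl // (path_sorted pl).
Qed.

Lemma sumn_pos l : sumn (filter (leq 1) l) = sumn l.
Proof. by elim: l => //= -[|a] l //= ->. Qed.

Lemma strip_partition A : sorted gtn A -> is_partition (strip A).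
Proof.
move=> sA; rewrite /is_partition filter_all andbT.
by rewrite sorted_filter ?sorted_unstack //; exact: geq_trans.
Qed.

(** Raising the entries by one compensates for the longer staircase: unstacking only gains a final
    zero, which [strip] erases. *)
Lemma strip_up A : strip (up true A) = strip A.
Proof.
rewrite /strip; have -> : unstack (up true A) = rcons (unstack A) 0.
  by elim: A => //= a A IHA; rewrite -/(up true A) IHA size_up addn1 subSS.
by rewrite -cats1 filter_cat cats0.
Qed.

Lemma sumn_strip A : sorted gtn A -> sumn A = sumn (strip A) + 'C(size A, 2).
Proof.
by move=> sA; rewrite sumn_pos -{1}(unstackK sA) sumn_stack size_unstack.
Qed.

(** The erased zeros are all at the end, and the size tells how many there were. *)
Lemma strip_inj A A' : sorted gtn A -> sorted gtn A' -> size A = size A' ->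
  strip A = strip A' -> A = A'.
Proof.
move=> sA sA' sz e; rewrite -(unstackK sA) -(unstackK sA'); congr stack.
rewrite (sorted_zeros (sorted_unstack sA)) (sorted_zeros (sorted_unstack sA')).
by rewrite -/(strip A) -/(strip A') e !size_unstack sz.
Qed.

Lemma strip_surj l k : is_partition l ->
  exists A, [/\ sorted gtn A, size A = size l + k & strip A = l].
Proof.
case/andP=> sl pl; exists (stack (l ++ nseq k 0)); split.
- apply: sorted_stack; case: l sl pl => [|a l] /=.
    by move=> _ _; elim: k => //= -[|k].
  rewrite cat_path => -> _ /=; by elim: k (last a l) => //= k IHk b.
- by rewrite size_stack size_cat size_nseq.
- rewrite /strip stackK filter_cat (all_filterP pl).
  by elim: k => //=; rewrite cats0.
Qed.

(* Enough shifts empty the second row; the first one is then a partition plus a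
   staircase, and further shifts only append zeros to that partition. *)
Definition pair_part (x : seq nat * seq nat) : seq nat :=
  strip (iter (sumn x.2).+1 shift x).1.

(** Frees [pair_part] from its particular number of shifts, so that two pairs can be compared after
    equally many. *)
Lemma pair_partE N x : (iter N shift x).2 = [::] ->
  pair_part x = strip (iter N shift x).1.
Proof.
have stable M y : y.2 = [::] -> strip (iter M shift y).1 = strip y.1 /\
    (iter M shift y).2 = [::].
  move=> y0; elim: M => //= M [<- ->]; split=> //; exact: strip_up.
have stab M K : K <= M -> (iter K shift x).2 = [::] ->
    strip (iter M shift x).1 = strip (iter K shift x).1.
  by move=> le x0; rewrite -(subnK le) iterD; have [] := stable (M - K) _ x0.
move=> xN; have x0 := @iter_shift_nil (sumn x.2).+1 x (ltnSn _).
by rewrite /pair_part; have [/stab->|/ltnW/stab<-] := leqP N (sumn x.2).+1.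
Qed.

Lemma pair_part_shift x : pair_part (shift x) = pair_part x.
Proof.
pose N := (sumn x.2 + sumn (shift x).2).+1.
have e : (iter N shift (shift x)).2 = [::] by apply: iter_shift_nil; rewrite /N; lia.
by rewrite (pair_partE e) -iterSr; rewrite -iterSr in e; rewrite -(pair_partE e).
Qed.

Lemma pair_part_iter_unshift N x :
  pair_sorted x -> pair_part (iter N unshift x) = pair_part x.
Proof.
move=> sx; elim: N => //= N <-; rewrite -pair_part_shift unshiftK //.
exact: pair_sorted_iter_unshift.
Qed.

Lemma pair_part_partition x : pair_sorted x -> is_partition (pair_part x).
Proof.
move=> sx; apply: strip_partition.
by have /andP[] := pair_sorted_iter_shift sx (sumn x.2).+1.
Qed.

(** After the shifts the pair is [(A, [::])], of charge [size A] and weight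
    [sumn (strip A) + 'C((size A).+1, 2)]; the invariant of [weight_iter_shift] carries this back to
    [x]. *)
Lemma weight_pair_part x : pair_sorted x ->
  weight x = sumn (pair_part x) + 'C((stair (charge x)).+1, 2).
Proof.
move=> sx; rewrite /pair_part; set N := (sumn x.2).+1.
have := weight_iter_shift sx N; have := pair_sorted_iter_shift sx N.
have := @iter_shift_nil N x (ltnSn _).
case: (iter N shift x) => A B /= -> /andP[/= sA _].
rewrite /weight /charge /= (sumn_strip sA).
by rewrite !addn0 (binS (size A) 1) bin1; lia.
Qed.

(** A common number of shifts empties both second rows. Equal charges then mean first rows of equal
    size, where [strip] is injective, and shifts are invertible. *)
Lemma pair_part_inj x y : pair_sorted x -> pair_sorted y ->
  charge x = charge y -> pair_part x = pair_part y -> x = y.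
Proof.
move=> sx sy cxy; pose N := (sumn x.2 + sumn y.2).+1.
have xN : (iter N shift x).2 = [::] by apply: iter_shift_nil; rewrite /N; lia.
have yN : (iter N shift y).2 = [::] by apply: iter_shift_nil; rewrite /N; lia.
rewrite (pair_partE xN) (pair_partE yN) => e.
rewrite -(iter_shiftK sx N) -(iter_shiftK sy N); congr iter.
have := charge_iter_shift sx N; rewrite cxy -(charge_iter_shift sy N).
have /andP[] := pair_sorted_iter_shift sx N.
have /andP[] := pair_sorted_iter_shift sy N.
move: e xN yN; case: (iter N shift x) => A B; case: (iter N shift y) => A' B' /=.
move=> e -> -> sA _ sA' _; rewrite /charge /= => c.
by congr pair; apply: strip_inj => //; lia.
Qed.

Lemma pair_part_surj z l : is_partition l ->
  exists x, [/\ pair_sorted x, charge x = z & pair_part x = l].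
Proof.
(* Padding by [|z|] zeros ensures [size A >= z], so that unshifting can lower the charge from
   [size A] to [z]. *)
move=> pl; have [A [sA szA <-]] := strip_surj `|z|%N pl.
have sx : pair_sorted (A, [::]) by rewrite /pair_sorted /= sA.
exists (iter (absz ((size A)%:Z - z)%R) unshift (A, [::])); split.
- exact: pair_sorted_iter_unshift.
- by rewrite charge_iter_unshift // /charge /=; lia.
- by rewrite pair_part_iter_unshift // (@pair_partE 0).
Qed.

(** * Adding a staircase *)

Lemma ltn_mex k l : (k < mex l) = all (mem l) (iota 1 k).
Proof.
rewrite /mex; case: ex_minnP => m /andP[m0 ml] minm.
apply/idP/allP => [km i|sub].
  rewrite mem_iota => /andP[i0 ik]; apply/negPn/negP => /= il.
  by have := minm i; rewrite i0 il => /(_ isT); lia.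
rewrite ltnNge; apply: contra ml => mk; apply: (sub m).
by rewrite mem_iota; lia.
Qed.

Lemma mex_le_sumn l : mex l <= (sumn l).+1.
Proof.
rewrite leqNgt ltn_mex; apply/negP => /allP /(_ (sumn l).+1).
rewrite mem_iota; move=> /(_ _) h; have {h} : (sumn l).+1 \in l by apply: h; lia.
elim: l => //= a l IHl; rewrite inE => /predU1P[|]; first lia.
suff: forall m, m \in l -> m <= sumn l by move=> h /h; lia.
by elim: (l) => //= b t IHt m; rewrite inE => /predU1P[->|/IHt]; lia.
Qed.

Definition add_stair k l := sort geq (iota 1 k ++ l).

Lemma perm_add_stair k l : perm_eq (add_stair k l) (iota 1 k ++ l).
Proof. by rewrite /add_stair perm_sort. Qed.

Lemma sumn_add_stair k l : sumn (add_stair k l) = sumn l + 'C(k.+1, 2).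
Proof.
rewrite (perm_sumn (perm_add_stair k l)) sumn_cat addnC; congr addn.
rewrite sumnE -bin2_sum big_ltn //=.
by rewrite /index_iota subSS subn0.
Qed.

Lemma add_stair_partition k l : is_partition l -> is_partition (add_stair k l).
Proof.
case/andP=> sl pl; rewrite /is_partition (sort_sorted geq_total).
rewrite (perm_all _ (perm_add_stair k l)) all_cat pl andbT /=.
by apply/allP => i; rewrite mem_iota; case/andP.
Qed.

Lemma mex_add_stair k l : k < mex (add_stair k l).
Proof.
rewrite ltn_mex; apply/allP => i ik.
by rewrite /= (perm_mem (perm_add_stair k l)) mem_cat ik.
Qed.

Lemma add_stair_inj k l l' : is_partition l -> is_partition l' ->
  add_stair k l = add_stair k l' -> l = l'.
Proof.
case/andP=> sl _ /andP[sl' _] e; apply: (sorted_eq geq_trans geq_anti) => //.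
rewrite -(perm_cat2l (iota 1 k)) -(permPl (perm_add_stair k l)) e.
exact: perm_add_stair.
Qed.

(** A mex above [k] means that each of [1, ..., k] is a part; removing one copy of each gives the
    preimage. *)
Lemma add_stair_surj k l : is_partition l -> k < mex l ->
  exists2 l', is_partition l' & add_stair k l' = l.
Proof.
case/andP=> sl pl; rewrite ltn_mex => /allP sub.
have [r lr] := perm_cat_uniq_sub (iota_uniq 1 k) sub.
exists (sort geq r).
  rewrite /is_partition (sort_sorted geq_total) all_sort.
  by move: pl; rewrite (perm_all _ lr) all_cat => /andP[].
apply: (sorted_eq geq_trans geq_anti) => //; first exact: sort_sorted geq_total _.
rewrite (permPl (perm_add_stair _ _)) perm_sym (permPl lr) perm_cat2l.
by rewrite perm_sym perm_sort.
Qed.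

Definition mex_part x := add_stair (stair (charge x)) (pair_part x).

Lemma mex_part_partition x : pair_sorted x -> is_partition (mex_part x).
Proof. by move=> sx; exact/add_stair_partition/pair_part_partition. Qed.

Lemma sumn_mex_part x : pair_sorted x -> sumn (mex_part x) = weight x.
Proof. by move=> sx; rewrite sumn_add_stair weight_pair_part. Qed.

Lemma mex_part_inj x y : pair_sorted x -> pair_sorted y ->
  charge x = charge y -> mex_part x = mex_part y -> x = y.
Proof.
move=> sx sy c; rewrite /mex_part c => /add_stair_inj e.
by apply: pair_part_inj => //; apply: e; exact: pair_part_partition.
Qed.

Lemma mex_part_surj z l : is_partition l -> stair z < mex l ->
  exists x, [/\ pair_sorted x, charge x = z & mex_part x = l].
Proof.
move=> pl /(add_stair_surj pl)[l' pl' <-].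
by have [x [sx <- <-]] := pair_part_surj z pl'; exists x.
Qed.

(** * Splitting the rows by color *)

Definition col (c : 'I_2) (R : seq colored_int) : seq nat :=
  [seq x.1 | x <- R & x.2 == c].

Lemma mem_col c R m : (m \in col c R) = ((m, c) \in R).
Proof.
apply/mapP/idP => [[[i d]]|mR]; last by exists (m, c); rewrite // mem_filter eqxx.
by rewrite mem_filter => /andP[/= /eqP -> ? ->].
Qed.

Lemma ord2P (c : 'I_2) : c = 0%R \/ c = 1%R.
Proof. by case: c => -[|[|//]] lt; [left|right]; apply: val_inj. Qed.

Lemma size_col R : size R = size (col 0%R R) + size (col 1%R R).
Proof.
elim: R => //= -[m c] R ->; rewrite /col /=.
by case: (ord2P c) => -> /=; rewrite ?addnS.
Qed.

Lemma sum_col R :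
  \sum_(x <- R) x.1 = sumn (col 0%R R) + sumn (col 1%R R).
Proof.
elim: R => [|[m c] R IHR]; first by rewrite big_nil.
rewrite big_cons IHR /col /=.
by case: (ord2P c) => -> /=; lia.
Qed.

Lemma gtEcolored (x y : colored_int) :
  (x > y)%O = (y.1 < x.1) || (y.1 == x.1) && (y.2 < x.2).
Proof.
case: x y => [m c] [i d]; rewrite ltEprodlexi !leEnat ltEord /=.
lia.
Qed.

Lemma gtc_trans : transitive (>%O : rel colored_int).
Proof. by move=> x y z yx /lt_trans; apply. Qed.

Lemma sorted_col c R : sorted >%O R -> sorted gtn (col c R).
Proof.
elim: R => //= -[m d] R IHR pR; rewrite /col /=.
have {IHR} := IHR (path_sorted pR).
case: eqP => //= dc sR; rewrite (path_sortedE gtn_trans) sR andbT.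
apply/allP => i; rewrite mem_col => iR.
have : (((m, d) : colored_int) > ((i, c) : colored_int))%O.
  exact: (allP (order_path_min gtc_trans pR) _ iR).
by rewrite gtEcolored /= dc ltnn andbF orbF.
Qed.

(** A strictly decreasing row is determined by its set of entries, and [mem_col] reads that set off
    the two colors. *)
Lemma col_inj R R' : sorted >%O R -> sorted >%O R' ->
  (forall c, col c R = col c R') -> R = R'.
Proof.
move=> sR sR' e; apply: (irr_sorted_eq gtc_trans) => //; first exact: ltxx.
by case=> m c; rewrite -!mem_col e.
Qed.

Lemma col_surj (A : 'I_2 -> seq nat) : (forall c, sorted gtn (A c)) ->
  exists2 R, sorted >%O R & forall c, col c R = A c.
Proof.
move=> sA; have uA c : uniq (A c) := sorted_uniq gtn_trans gtn_irr (sA c).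
pose s : seq colored_int := [seq (m, c) | c <- enum 'I_2, m <- A c].
(* The sort is increasing, hence the reversal; strictness comes from the entries of [s] being
   distinct. *)
have sR : sorted >%O (rev (sort <=%O s)).
  rewrite rev_sorted sort_lt_sorted.
  apply: allpairs_uniq_dep => //; first exact: enum_uniq.
  by move=> [c m] [c' m'] _ _ [-> ->].
exists (rev (sort <=%O s)) => // c.
apply: (irr_sorted_eq gtn_trans gtn_irr) => //; first exact: sorted_col.
move=> m; rewrite mem_col mem_rev mem_sort.
apply/allpairsPdep/idP => [[d [i [_ + [-> ->]]]]|mA] //.
by exists c, m; rewrite mem_enum.
Qed.

Definition color_pair (c : 'I_2) (P : frob_array) := (col c P.1, col c P.2).

Definition frob_mex_parts (P : frob_array) :=
  (mex_part (color_pair 0%R P), mex_part (color_pair 1%R P)).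

Lemma is_frobE a P : is_frob a P =
  [&& sorted >%O P.1, sorted >%O P.2 &
      (charge (color_pair 0%R P) + charge (color_pair 1%R P) == a%:Z - 1)%R].
Proof.
rewrite /is_frob /charge /= (size_col P.1) (size_col P.2).
do 2 congr andb; congr (_ == _); lia.
Qed.

Lemma frob_weightE P : frob_weight P =
  weight (color_pair 0%R P) + weight (color_pair 1%R P).
Proof. rewrite /frob_weight /weight !sum_col (size_col P.1) /=; lia. Qed.

Lemma pair_sorted_color_pair a c P : is_frob a P -> pair_sorted (color_pair c P).
Proof. by case/and3P=> s1 s2 _; rewrite /pair_sorted !sorted_col. Qed.

Lemma mem_frob_set a n P :
  (P \in fset_set (frob_set a n)) = is_frob a P && (frob_weight P == n).
Proof.
rewrite in_fset_set; last exact: finite_frob_set.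
by apply/idP/andP; rewrite inE => -[fP /eqP wP].
Qed.

Lemma mem_bipartitions n pi : (pi \in fset_set (bipartitions n)) =
  [&& is_partition pi.1, is_partition pi.2 & sumn pi.1 + sumn pi.2 == n].
Proof.
rewrite in_fset_set; last exact: finite_bipartitions.
by apply/idP/and3P; rewrite inE => -[p1 p2 /eqP e].
Qed.

Lemma frob_mex_parts_bipartition a n P : P \in fset_set (frob_set a n) ->
  frob_mex_parts P \in fset_set (bipartitions n).
Proof.
rewrite mem_frob_set mem_bipartitions frob_weightE => /andP[fP].
by rewrite /= !mex_part_partition ?sumn_mex_part ?(pair_sorted_color_pair _ fP).
Qed.

(** * Counting by charge *)

Definition mex_count n i j :=
  count (fun pi => (i < mex pi.1) && (j < mex pi.2)) (fset_set (bipartitions n)).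

(** Charge [z] in color 0 forces charge [a - 1 - z] in color 1. With both charges fixed,
    [frob_mex_parts] is a bijection onto the bipartitions whose mexes exceed the two stairs. *)
Lemma count_charge a n z :
  count (fun P => charge (color_pair 0%R P) == z) (fset_set (frob_set a n)) =
  mex_count n (stair z) (stair (a%:Z - 1 - z)%R).
Proof.
apply: (count_bij (f := frob_mex_parts)); rewrite ?fset_uniq //.
- move=> P PX /eqP zP; rewrite (frob_mex_parts_bipartition PX) /= -{1}zP.
  move: PX; rewrite mem_frob_set is_frobE => /andP[/and3P[_ _ /eqP <-] _].
  rewrite mex_add_stair /= -zP; have -> : forall b c : int, (b + c - b = c)%R by lia.
  exact: mex_add_stair.
- move=> P Q; rewrite !mem_frob_set => /andP[fP _] /eqP zP /andP[fQ _] /eqP zQ.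
  case=> e0 e1; move: (fP) (fQ); rewrite !is_frobE.
  move=> /and3P[sP1 sP2 /eqP cP] /and3P[sQ1 sQ2 /eqP cQ].
  have eq0 : color_pair 0%R P = color_pair 0%R Q.
    apply: mex_part_inj e0; rewrite ?zP ?zQ //.
      exact: pair_sorted_color_pair fP.
    exact: pair_sorted_color_pair fQ.
  have eq1 : color_pair 1%R P = color_pair 1%R Q.
    apply: mex_part_inj e1; last by lia.
      exact: pair_sorted_color_pair fP.
    exact: pair_sorted_color_pair fQ.
  have {eq0 eq1} e c : color_pair c P = color_pair c Q.
    by case: (ord2P c) => ->.
  rewrite [P]surjective_pairing [Q]surjective_pairing.
  by congr pair; apply: col_inj => // c; case: (e c).
- move=> [l0 l1]; rewrite mem_bipartitions /= => /and3P[p0 p1 /eqP ln].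
  case/andP=> /(mex_part_surj p0)[x0 [s0 c0 e0]] /(mex_part_surj p1)[x1 [s1 c1 e1]].
  pose x (c : 'I_2) := if c == 0%R then x0 else x1.
  have sx c : pair_sorted (x c) by rewrite /x; case: eqP.
  have [|R1 sR1 R1x] := @col_surj (fun c => (x c).1).
    by move=> c; case/andP: (sx c).
  have [|R2 sR2 R2x] := @col_surj (fun c => (x c).2).
    by move=> c; case/andP: (sx c).
  have xE c : color_pair c (R1, R2) = x c.
    by rewrite /color_pair /= R1x R2x -surjective_pairing.
  have x0E : color_pair 0%R (R1, R2) = x0 by rewrite xE.
  have x1E : color_pair 1%R (R1, R2) = x1 by rewrite xE.
  exists (R1, R2); last by rewrite /frob_mex_parts x0E x1E e0 e1.
  rewrite mem_frob_set is_frobE frob_weightE x0E x1E sR1 sR2 c0 c1 eqxx /= andbT.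
  rewrite -ln -e0 -e1 !sumn_mex_part // eqxx andbT; apply/eqP; lia.
Qed.

Lemma stair_eq z (k : nat) : (stair z == k) = (z == Posz k) || (z == Negz k).
Proof. by case: z => i; rewrite ?orbF. Qed.

Lemma mex_bipartition n pi : pi \in fset_set (bipartitions n) ->
  [/\ 0 < mex pi.1 <= n.+1 & 0 < mex pi.2 <= n.+1].
Proof.
rewrite mem_bipartitions => /and3P[_ _ /eqP <-].
have := mex_le_sumn pi.1; have := mex_le_sumn pi.2.
by rewrite !(ltn_mex 0) /= => h1 h2; split; lia.
Qed.

(** Arrays are sorted by the stair [k] of their color 0 charge, which is then [k] or [-1 - k]. Since
    [k] lies below a mex, it is at most [n]. *)
Lemma cpsi2E a n : cpsi2 a n =
  \sum_(k < n.+1) (mex_count n k (stair (a%:Z - 1 - Posz k)%R) +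
                   mex_count n k (stair (a%:Z - 1 - Negz k)%R)).
Proof.
rewrite [LHS](esym (count_predT _)).
rewrite (count_sum_ord (N := n.+1) (f := fun P => stair (charge (color_pair 0%R P)))).
  apply: eq_bigr => k _; rewrite -(count_charge a n (Posz k)) -(count_charge a n (Negz k)).
  rewrite -count_predUI.
  rewrite [X in _ + X](eq_count (a2 := pred0)) ?count_pred0 ?addn0.
    by apply: eq_count => P /=; rewrite stair_eq.
  by move=> P /=; apply/andP => -[/eqP ->].
move=> P PX _; have [/andP[_ h] _] := mex_bipartition (frob_mex_parts_bipartition PX).
exact: leq_trans (mex_add_stair _ _) h.
Qed.

(** * The excludant statistics in terms of [mex_count] *)

Lemma count_sum (T : Type) (s : seq T) (P : pred T) :
  count P s = \sum_(x <- s) P x.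
Proof. by elim: s => [|x s IHs]; rewrite ?big_nil // big_cons -IHs. Qed.

Lemma sum_ltn_ord m N : m <= N -> \sum_(k < N) (k < m) = m.
Proof.
elim: N => [|N IHN] mN; first by rewrite big_ord0; lia.
rewrite big_ord_recr /=; have [mN'|] := leqP m N; first by rewrite IHN //; lia.
move=> Nm; have -> : m = N.+1 by lia.
rewrite (eq_bigr (fun=> 1)) ?sum_nat_const ?card_ord ?muln1 ?addn1 ?ltnSn // => i _.
by rewrite (leqW (ltn_ord i)).
Qed.

(** [mex2 pi] is the number of [k] below both mexes; the two sums are then exchanged. *)
Lemma sigma_mex2E n : sigma_mex2 n = \sum_(k < n.+1) mex_count n k k.
Proof.
under eq_bigr do rewrite /mex_count count_sum.
rewrite exchange_big /sigma_mex2 /=; apply: eq_big_seq => pi.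
case/mex_bipartition=> /andP[_ le1] _.
rewrite -[LHS](@sum_ltn_ord _ n.+1) ?geq_min ?le1 //.
by apply: eq_bigr => k _; rewrite /mex2 ltn_min.
Qed.

(** For each [k], the indicator of both mexes being [k + 1] is the product of the differences
    [[k < m] - [k + 1 < m]] over the two mexes. Its negative terms are moved to the left to stay in
    [nat]. *)
Lemma E2E n : E2 n + \sum_(k < n.+1) (mex_count n k.+1 k + mex_count n k k.+1) =
  \sum_(k < n.+1) (mex_count n k k + mex_count n k.+1 k.+1).
Proof.
have -> : E2 n = count (fun pi => mex pi.1 == mex pi.2) (fset_set (bipartitions n)).
  rewrite -size_filter; apply/perm_size/uniq_perm; rewrite ?filter_uniq ?fset_uniq //.
  move=> pi; rewrite mem_filter in_fset_set; last first.
    by apply: sub_finite_set (finite_bipartitions n) => ? [].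
  rewrite in_fset_set; last exact: finite_bipartitions.
  by apply/idP/andP; rewrite !inE => -[]; [move=> ? /eqP | move=> /eqP].
rewrite (count_sum_ord (N := n.+1) (f := fun pi => (mex pi.1).-1)); last first.
  by move=> pi /mex_bipartition[]; case: (mex _).
rewrite -big_split /=; apply: eq_bigr => k _.
rewrite /mex_count !count_sum -!big_split; apply: eq_big_seq => pi /=.
case/mex_bipartition; move: (mex pi.1) (mex pi.2) => m1 m2; lia.
Qed.

Lemma mex_count_out n j : mex_count n n.+1 j = 0.
Proof.
apply/eqP; rewrite eqn0Ngt -has_count; apply/hasPn => pi /mex_bipartition[/andP[_ h] _].
by rewrite negb_and -leqNgt h.
Qed.

Theorem corollary3p4 (n : nat) :
  cpsi2 0 n = (2 * sigma_mex2 n)%N /\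
  ((cpsi2 1 n)%:Z = 2 * (sigma_mex2 n)%:Z - (E2 n)%:Z)%R.
Proof.
split.
  (* For [a = 0] the second charge is [-1 - z], which has the same stair as [z], so every term is
     diagonal. *)
  rewrite cpsi2E sigma_mex2E big_distrr; apply: eq_bigr => k _.
  have -> : (Posz 0 - 1 - Posz k)%R = Negz k by lia.
  have -> : (Posz 0 - 1 - Negz k)%R = Posz k by lia.
  by rewrite /= mul2n addnn.
have := E2E n; rewrite sigma_mex2E cpsi2E !big_split.
have -> : \sum_(k < n.+1) mex_count n k (stair (Posz 1 - 1 - Negz k)%R) =
          \sum_(k < n.+1) mex_count n k k.+1.
  apply: eq_bigr => k _.
  by have -> : (Posz 1 - 1 - Negz k)%R = Posz k.+1 by lia.
have -> : \sum_(k < n.+1) mex_count n k (stair (Posz 1 - 1 - Posz k)%R) =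
          mex_count n 0 0 + \sum_(k < n.+1) mex_count n k.+1 k.
  (* For [a = 1] the charge [k] is paired with [-k], whose stair is [k - 1] for positive [k] and 0
     for [k = 0]; truncated [k.-1] covers both. After reindexing, the extra last term vanishes by
     [mex_count_out]. *)
  rewrite (eq_bigr (fun k : 'I_n.+1 => mex_count n k k.-1)) => [|k _].
    by rewrite [LHS]big_ord_recl [in RHS]big_ord_recr /= mex_count_out addn0.
  case: (nat_of_ord k) => // {}k; congr mex_count.
  by have -> : (Posz 1 - 1 - Posz k.+1)%R = Negz k by lia.
have : \sum_(k < n.+1) mex_count n k k =
       mex_count n 0 0 + \sum_(k < n.+1) mex_count n k.+1 k.+1.
  by rewrite [LHS]big_ord_recl [in RHS]big_ord_recr /= mex_count_out addn0.
(* With [D] the diagonal sum, [E2E] makes the off-diagonal sums equal to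
   [D + (D - mex_count n 0 0) - E2 n]; adding [mex_count n 0 0] leaves [2 * D - E2 n]. *)
move=> /= ? ?; lia.
Qed.
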